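(* Let $S$ be the unilateral shift on $\ell^2$, $Se_n=e_{n+1}$ for $n\ge 0$, where $(e_n)_{n\ge 0}$ is the standard orthonormal basis. Let $0<\lambda\le 1$ and let $X$ be an extended eigenoperator of $I-S^*$ associated with $\lambda$, i.e. $X$ is a nonzero bounded linear operator on $\ell^2$ with $(I-S^* )X=\lambda X(I-S^* )$. Then there is a two-sided sequence $(\alpha_n)_{n\in\mathbb Z}$ of complex scalars with $\alpha_0\neq 0$ and $\alpha_n=0$ for all $n\ge 1$, and there is an $n_0\in\mathbb N=\{0,1,2,\dots\}$, such that $X$ admits the factorization $$X=E_\lambda A(S^* )^{n_0},$$ where $E_\lambda$ is the Euler operator and $A$ is the co-analytic Toeplitz matrix associated with $(\alpha_n)_{n\in\mathbb Z}$.
   Context: The Euler operator $E_\lambda$ is defined on $\ell^2$ by $(E_\lambda f)(n)=\sum_{k=0}^n\binom nk\lambda^k(1-\lambda)^{n-k}f(k)$, $n\ge 0$; it is bounded for $0<\lambda\le1$. The Toeplitz matrix associated with $(\alpha_n)_{n\in\mathbb Z}$ is the infinite matrix $A=(a_{nk})_{n,k\ge 0}$ with $a_{nk}=\alpha_{n-k}$; it is called co-analytic when $\alpha_n=0$ for all $n>0$, so that $A$ is upper triangular and each column has only finitely many nonzero entries. No boundedness of $A$ on $\ell^2$ is asserted: the factorization is an identity of infinite matrices, i.e. $Xe_k=E_\lambda A(S^* )^{n_0}e_k$ for every $k\ge 0$. *)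

(* Defs.v *)
From HB Require Import structures.
From mathcomp Require Import all_boot all_order all_algebra.
From mathcomp Require Import all_classical all_reals all_analysis.
From mathcomp Require Import complex lra.

Set Implicit Arguments.
Unset Strict Implicit.
Unset Printing Implicit Defensive.

Import Order.TTheory GRing.Theory Num.Theory.
Import numFieldNormedType.Exports.
Import ComplexField.Normc.

Local Open Scope classical_set_scope.
Local Open Scope ring_scope.
Local Open Scope complex_scope.

Section SquareSummable.
Context {R : realType}.
Implicit Types f g : nat -> R[i].

Definition sqseries f : nat -> R := series (fun k => normc (f k) ^+ 2).

Definition square_summable : {pred nat -> R[i]} :=
  fun f => `[< cvgn (sqseries f) >].

Lemma square_summableP f : reflect (cvgn (sqseries f)) (f \in square_summable).
Proof. exact: asboolP. Qed.

Lemma normc_ge0 (z : R[i]) : 0 <= normc z.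
Proof. by case: z => a b; rewrite /= sqrtr_ge0. Qed.

Lemma sqseries_ge0 f n : 0 <= sqseries f n.
Proof. by apply: sumr_ge0 => k _; rewrite exprn_ge0 ?normc_ge0. Qed.

Lemma sqseries_nondecreasing f : nondecreasing_seq (sqseries f).
Proof.
apply/nondecreasing_seqP => n; rewrite /sqseries seriesSr lerDl.
by rewrite exprn_ge0 ?normc_ge0.
Qed.

Lemma sqseries_le_lim f n : f \in square_summable ->
  sqseries f n <= limn (sqseries f).
Proof.
move=> /square_summableP cf.
exact: (nondecreasing_cvgn_le (sqseries_nondecreasing f) cf n).
Qed.

Lemma sqseries_lim_ge0 f : f \in square_summable -> 0 <= limn (sqseries f).
Proof. by move=> /(sqseries_le_lim 0) /(le_trans (sqseries_ge0 f 0)). Qed.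

Lemma bounded_square_summable f M :
  (forall n, sqseries f n <= M) -> f \in square_summable.
Proof.
move=> fM; apply/square_summableP.
apply: nondecreasing_is_cvgn; first exact: sqseries_nondecreasing.
by exists M => _ [n _ <-].
Qed.

Lemma sqseriesD_le f g n : sqseries (f + g) n <=
  (Num.sqrt (sqseries f n) + Num.sqrt (sqseries g n)) ^+ 2.
Proof.
elim: n => [|n IHn]; first by rewrite /sqseries /series/= big_geq// sqr_ge0.
rewrite /sqseries !seriesSr -!/(sqseries _ n).
set A := sqseries f n; set B := sqseries g n.
set a := normc (f n); set b := normc (g n).
have a0 : 0 <= a by exact: normc_ge0.
have b0 : 0 <= b by exact: normc_ge0.
have A0 : 0 <= A by exact: sqseries_ge0.
have B0 : 0 <= B by exact: sqseries_ge0.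
have abn : normc ((f + g) n) ^+ 2 <= (a + b) ^+ 2.
  by rewrite ler_pXn2r ?nnegrE ?normc_ge0 ?addr_ge0//; exact: le_normcD.
apply: (le_trans (lerD IHn abn)).
rewrite !sqrrD !sqr_sqrtr ?addr_ge0 ?sqr_ge0//.
rewrite -!sqrtrM ?addr_ge0 ?sqr_ge0//.
suff : Num.sqrt (A * B) + a * b <= Num.sqrt ((A + a ^+ 2) * (B + b ^+ 2)).
  by rewrite -/A -/B !mulr2n; lra.
rewrite -(@ler_pXn2r _ 2) ?nnegrE ?sqrtr_ge0 ?addr_ge0 ?mulr_ge0 ?sqrtr_ge0//.
rewrite sqr_sqrtr ?mulr_ge0 ?addr_ge0 ?sqr_ge0// sqrrD sqr_sqrtr ?mulr_ge0//.
rewrite sqrtrM//.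
have := sqr_ge0 (Num.sqrt A * b - Num.sqrt B * a).
rewrite sqrrB !exprMn !sqr_sqrtr//; lra.
Qed.

Lemma sqseriesD_le_lim f g n : f \in square_summable -> g \in square_summable ->
  sqseries (f + g) n <=
  (Num.sqrt (limn (sqseries f)) + Num.sqrt (limn (sqseries g))) ^+ 2.
Proof.
move=> lf lg; apply: (le_trans (sqseriesD_le f g n)).
rewrite ler_pXn2r ?nnegrE ?addr_ge0 ?sqrtr_ge0//.
by rewrite lerD// ler_wsqrtr// sqseries_le_lim.
Qed.

Lemma sqseriesZ (c : R[i]) f :
  sqseries (c *: f) = (fun n => normc c ^+ 2 * sqseries f n).
Proof.
apply/funext => n; rewrite /sqseries /series/= big_distrr/=.
by apply: eq_bigr => k _; rewrite normcM exprMn.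
Qed.

Lemma sqseries_limZ (c : R[i]) f : f \in square_summable ->
  sqseries (c *: f) @ \oo --> normc c ^+ 2 * limn (sqseries f).
Proof. by move=> /square_summableP cf; rewrite sqseriesZ; apply: cvgMr. Qed.

Lemma square_summable_submod_closed : submod_closed square_summable.
Proof.
split=> [|c f g lf lg].
  apply: (@bounded_square_summable _ 0) => n.
  rewrite /sqseries /series/= big1// => k _.
  by rewrite expr0n addr0 sqrtr0 expr0n.
have lcf : c *: f \in square_summable.
  by apply/square_summableP; apply: cvgP; exact: sqseries_limZ.
exact: bounded_square_summable (fun n => sqseriesD_le_lim n lcf lg).
Qed.

HB.instance Definition _ := GRing.isSubmodClosed.Build _ _ square_summable
  square_summable_submod_closed.

End SquareSummable.

Record ell2 (R : realType) := Ell2 {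
  ell2_seq :> nat -> R[i];
  ell2_seqP : ell2_seq \in square_summable }.

Section Ell2.
Context {R : realType}.

HB.instance Definition _ := [isSub for @ell2_seq R].
HB.instance Definition _ := [Choice of ell2 R by <:].
HB.instance Definition _ := [SubChoice_isSubLmodule of ell2 R by <:].

Definition ell2_norm (f : ell2 R) : R := Num.sqrt (limn (sqseries f)).

Lemma ell2_normD (f g : ell2 R) : ell2_norm (f + g) <= ell2_norm f + ell2_norm g.
Proof.
rewrite -(@ler_pXn2r _ 2) ?nnegrE ?addr_ge0 ?sqrtr_ge0//.
rewrite sqr_sqrtr ?sqseries_lim_ge0 ?ell2_seqP//.
apply: limr_le; first exact/square_summableP/ell2_seqP.
by apply: nearW => n; apply: sqseriesD_le_lim; exact: ell2_seqP.
Qed.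

Lemma ell2_normZ (c : R[i]) (f : ell2 R) :
  ell2_norm (c *: f) = normc c * ell2_norm f.
Proof.
rewrite /ell2_norm (cvg_lim _ (@sqseries_limZ _ c f (ell2_seqP f)))//.
by rewrite sqrtrM ?sqr_ge0// sqrtr_sqr ger0_norm// normc_ge0.
Qed.

Lemma ell2_norm_eq0 (f : ell2 R) : ell2_norm f = 0 -> f = 0.
Proof.
move=> /eqP; rewrite sqrtr_eq0 => f0; apply: val_inj; apply/funext => k.
apply: eq0_normc; apply/eqP; rewrite -sqrf_eq0 eq_le sqr_ge0 andbT.
apply: le_trans f0; apply: le_trans (sqseries_le_lim k.+1 (ell2_seqP f)).
by rewrite /sqseries seriesSr lerDr; exact: sqseries_ge0.
Qed.

(* The norm of a normed R[i]-module takes values in R[i]. *)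
Let ell2_normc (f : ell2 R) : R[i] := (ell2_norm f)%:C.

Let ell2_normcD (f g : ell2 R) :
  ell2_normc (f + g) <= ell2_normc f + ell2_normc g.
Proof. by rewrite -rmorphD/= lecR ell2_normD. Qed.

Let ell2_normcZ (c : R[i]) (f : ell2 R) :
  ell2_normc (c *: f) = `|c| * ell2_normc f.
Proof. by rewrite /ell2_normc ell2_normZ rmorphM. Qed.

Let ell2_normc_eq0 (f : ell2 R) : ell2_normc f = 0 -> f = 0.
Proof. by move=> [/ell2_norm_eq0]. Qed.

HB.instance Definition _ := Lmodule_isNormed.Build R[i] (ell2 R)
  ell2_normcD ell2_normcZ ell2_normc_eq0.

Lemma ell2_normE (f : ell2 R) : `|f| = (Num.sqrt (limn (sqseries f)))%:C.
Proof. by []. Qed.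

End Ell2.

Section Operators.
Context {R : realType}.
Implicit Types f g : ell2 R.

Definition bounded_operator (X : ell2 R -> ell2 R) : Prop :=
  exists M : R, forall f, `|X f| <= M%:C * `|f|.

Definition inner f g : R[i] :=
  limn (series (fun k => f k * (g k)^*) : nat -> R[i]^o).

Lemma std_basis_subproof n :
  (fun k => (k == n)%:R : R[i]) \in @square_summable R.
Proof.
apply: (@bounded_square_summable _ _ 1) => m; rewrite /sqseries /series/=.
suff -> : \sum_(0 <= k < m) normc ((k == n)%:R : R[i]) ^+ 2 =
          (n < m)%:R :> R by case: (_ < _)%N.
elim: m => [|m IHm]; first by rewrite big_geq.
rewrite big_nat_recr//= IHm ltnS [in RHS]leq_eqVlt (eq_sym n m).
case: eqVneq => [->|_]; first by rewrite ltnn normc1 expr1n add0r.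
by rewrite normc0 expr0n addr0.
Qed.

Definition std_basis (n : nat) : ell2 R := Ell2 (std_basis_subproof n).

Lemma shift_subproof f :
  (fun k => if k is k'.+1 then f k' else 0) \in @square_summable R.
Proof.
apply: (@bounded_square_summable _ _ (limn (sqseries f))) => -[|n].
  by rewrite /sqseries /series/= big_geq// sqseries_lim_ge0 ?ell2_seqP.
apply: le_trans (sqseries_le_lim n (ell2_seqP f)).
rewrite /sqseries /series/= big_nat_recl//= expr0n/= addr0.
by rewrite sqrtr0 expr0n add0r.
Qed.

Definition shift f : ell2 R := Ell2 (shift_subproof f).

Lemma shift_std_basis n : shift (std_basis n) = std_basis n.+1.
Proof. by apply: val_inj; apply/funext => -[|k]. Qed.

Lemma shift_adj_subproof f : (fun k => f k.+1) \in @square_summable R.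
Proof.
apply: (@bounded_square_summable _ _ (limn (sqseries f))) => n.
apply: le_trans (sqseries_le_lim n.+1 (ell2_seqP f)).
rewrite /sqseries /series/= [leRHS]big_nat_recl//= lerDr.
by rewrite exprn_ge0 ?normc_ge0.
Qed.

(* The adjoint S^* of the unilateral shift, see shift_adjP. *)
Definition shift_adj f : ell2 R := Ell2 (shift_adj_subproof f).

Lemma shift_adjP f g : inner (shift f) g = inner f (shift_adj g).
Proof.
have limS (V : ptopologicalType) (u : nat -> V) :
    limn u = limn (fun n => u n.+1).
  rewrite /lim /lim_in; congr xget; apply/funext => l.
  by rewrite -[LHS](cvg_shiftS u).
rewrite /inner limS; apply: (congr1 (fun u : nat -> R[i]^o => limn u)).
by apply/funext => n; rewrite /series/= big_nat_recl//= mul0r add0r.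
Qed.

Definition extended_eigenoperator (T : ell2 R -> ell2 R) (mu : R[i])
    (X : {linear ell2 R -> ell2 R}) : Prop :=
  [/\ ~ (X =1 (fun=> 0)), bounded_operator X &
      forall f, T (X f) = mu *: X (T f)].

End Operators.

Section Matrices.
Context {R : realType}.

(* Defined on all sequences: row n of the Euler matrix has finite support, so
   no summability of f is needed. *)
Definition euler (lambda : R) (f : nat -> R[i]) : nat -> R[i] := fun n =>
  \sum_(0 <= k < n.+1)
    'C(n, k)%:R * lambda%:C ^+ k * (1 - lambda%:C) ^+ (n - k) * f k.

Definition toeplitz (alpha : int -> R[i]) : nat -> nat -> R[i] :=
  fun n k => alpha (n%:Z - k%:Z).

Definition coanalytic (alpha : int -> R[i]) : Prop :=
  forall n : int, 0 < n -> alpha n = 0.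

(* (A v)_n is the sum of the series of the A n k * v k; it is a junk value if
   this series diverges. *)
Definition matrix_apply (A : nat -> nat -> R[i]) (v : nat -> R[i]) :
    nat -> R[i] :=
  fun n => limn (series (fun k => A n k * v k) : nat -> R[i]^o).

Lemma matrix_apply_finite (A : nat -> nat -> R[i]) (v : nat -> R[i]) N n :
  (forall k, (N <= k)%N -> v k = 0) ->
  matrix_apply A v n = \sum_(0 <= k < N) A n k * v k.
Proof.
move=> v0; apply: (@cvg_lim R[i]^o); first exact: norm_hausdorff.
apply: (@cvg_near_cst _ R[i]^o); exists N => // m /= Nm.
rewrite /series/= (big_cat_nat (leq0n N) Nm)/= -[RHS]addr0; congr (_ + _).
rewrite big_nat_cond big1// => k; rewrite andbT => /andP[Nk _].
by rewrite v0// mulr0.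
Qed.

End Matrices.

(* Main.v *)
Require Import Defs.
From mathcomp Require Import all_boot all_order all_algebra.
From mathcomp Require Import all_classical all_reals all_analysis.
From mathcomp Require Import complex zify ring.

Set Implicit Arguments.
Unset Strict Implicit.
Unset Printing Implicit Defensive.

Import Order.TTheory GRing.Theory Num.Theory.
Import numFieldNormedType.Exports.

Local Open Scope ring_scope.
Local Open Scope complex_scope.

(** Evaluating the relation at [e_k] gives [S^* X e_k = (1 - lambda) X e_k +
    lambda X e_(k-1)], with [e_(-1) = 0]. By Pascal's rule the Euler transform
    satisfies the same recurrence, so [X e_k] is the Euler transform of
    [(b_k, b_(k-1), ..., b_0, 0, ...)], where [b_k] is the zeroth coordinate of
    [X e_k]. These are the columns of an upper triangular Toeplitz matrix. As
    [X] is bounded and nonzero, the [b_k] do not all vanish; if [b_n0] is the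
    first nonzero one, shifting by [n0] puts it on the diagonal. *)

Lemma euler0 (R : realType) (lambda : R) (f : nat -> R[i]) :
  euler lambda f 0 = f 0.
Proof. by rewrite /euler big_nat1 bin0 !expr0 !mul1r. Qed.

(* Pascal's rule; in operator form, S^* E = E ((1 - lambda) I + lambda S^* ). *)
Lemma eulerS (R : realType) (lambda : R) (f : nat -> R[i]) n :
  euler lambda f n.+1 = (1 - lambda%:C) * euler lambda f n
    + lambda%:C * euler lambda (fun k => f k.+1) n.
Proof.
rewrite /euler big_nat_recl//.
(* Splitting off [k = 0] leaves [n] terms; the upper bound [n.+1] can be kept because
   ['C(n, n.+1) = 0]. *)
have -> : \sum_(0 <= k < n.+1) 'C(n, k)%:R * lambda%:C ^+ k *
      (1 - lambda%:C) ^+ (n - k) * f k = (1 - lambda%:C) ^+ n * f 0 +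
    \sum_(0 <= k < n.+1) 'C(n, k.+1)%:R * lambda%:C ^+ k.+1 *
      (1 - lambda%:C) ^+ (n - k.+1) * f k.+1.
  rewrite big_nat_recl// bin0 expr0 !mul1r subn0; congr (_ + _).
  by rewrite [RHS]big_nat_recr//= bin_small// !mul0r addr0.
rewrite bin0 expr0 !mul1r subn0 exprS mulrDr -addrA mulrA; congr (_ + _).
rewrite !big_distrr -big_split/=; apply: eq_big_nat => k /andP[_ kn].
(* At [k = n] the exponent [n - k.+1] is truncated, but its coefficient ['C(n, k.+1)] is zero. *)
rewrite binS natrD subSS; have [lt_kn|le_nk] := ltnP k n.
  by rewrite -(subnSK lt_kn) !exprS; ring.
by rewrite bin_small//= exprS; ring.
Qed.

Lemma iter_shift_adjE (R : realType) (f : ell2 R) m k :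
  iter m shift_adj f k = f (k + m)%N.
Proof. by elim: m k => [|m IHm] k; rewrite ?addn0// iterS /= IHm addSnnS. Qed.

Lemma toeplitz_iter_shift_adj_basis (R : realType) (alpha : int -> R[i]) m k n :
  matrix_apply (toeplitz alpha) (iter m shift_adj (std_basis k)) n =
  if (m <= k)%N then alpha (n%:Z - (k - m)%N%:Z) else 0.
Proof.
rewrite (@matrix_apply_finite _ _ _ k.+1) => [|j kj]; last first.
  by rewrite iter_shift_adjE /= (_ : (j + m == k)%N = false)//; lia.
under eq_bigr do rewrite iter_shift_adjE /= mulr_natr mulrb.
rewrite -big_mkcond /=; case: leqP => mk.
  rewrite (eq_bigl (fun j => j == (k - m)%N)) => [|j]; last by apply/eqP/eqP; lia.
  by rewrite big_nat1_eq (_ : (_ <= _ < _)%N = true)//; lia.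
by rewrite big1// => j /eqP; lia.
Qed.

Lemma ell2_sumE (R : realType) (F : nat -> ell2 R) n k :
  (\sum_(0 <= j < n) F j : ell2 R) k = \sum_(0 <= j < n) F j k.
Proof. elim: n => [|n IHn]; first by rewrite !big_geq.
by rewrite !big_nat_recr//= -IHn. Qed.

Lemma ell2_truncE (R : realType) (f : ell2 R) n k :
  (\sum_(0 <= j < n) f j *: std_basis j : ell2 R) k =
  if (k < n)%N then f k else 0.
Proof.
rewrite ell2_sumE (eq_bigr (fun j => if j == k then f j else 0)) => [|j _].
  by rewrite -big_mkcond big_nat1_eq.
by rewrite [LHS](_ : _ = f j * (k == j)%:R)// eq_sym mulr_natr mulrb.
Qed.

Lemma sqseries_trunc_le (R : realType) (f : ell2 R) n m :
  sqseries (f - \sum_(0 <= j < n) f j *: std_basis j : ell2 R) m <=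
  limn (sqseries f) - sqseries f n.
Proof.
have tailE k : (f - \sum_(0 <= j < n) f j *: std_basis j : ell2 R) k =
    if (k < n)%N then 0 else f k.
  transitivity (f k - (\sum_(0 <= j < n) f j *: std_basis j : ell2 R) k) => //.
  by rewrite ell2_truncE; case: ifP => _; rewrite ?subrr ?subr0.
move: (f - _) tailE => g tailE.
rewrite lerBrDr; apply: le_trans (sqseries_le_lim (maxn m n) (ell2_seqP f)).
(* Passing to [maxn m n] allows both sums to be cut at [n], even when [m < n]. *)
rewrite (le_trans (lerD (sqseries_nondecreasing _ (leq_maxl m n)) (lexx _)))//.
rewrite /sqseries /series /= !(big_cat_nat (leq0n n) (leq_maxr m n))/=.
rewrite big_nat big1 => [|k /andP[_ kn]]; last first.
  by rewrite tailE kn ComplexField.Normc.normc0 expr0n.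
rewrite add0r addrC; apply: lerD => //; rewrite big_nat [leRHS]big_nat.
by apply: ler_sum => k /andP[nk _]; rewrite tailE ltnNge nk.
Qed.

Lemma cvg_ell2_trunc (R : realType) (f : ell2 R) (e : R) : 0 < e ->
  exists n, ell2_norm (f - \sum_(0 <= j < n) f j *: std_basis j) <= e.
Proof.
move=> e0; have cf := square_summableP _ (ell2_seqP f).
have e20 : 0 < e ^+ 2 by rewrite exprn_gt0.
have /cvgrPdist_le/(_ _ e20)[n _ /(_ n (leqnn n))/= fn] := cf.
exists n; rewrite -(ger0_norm (ltW e0)) -sqrtr_sqr ler_wsqrtr//.
apply: limr_le; first exact/square_summableP/ell2_seqP.
apply: nearW => m; apply: le_trans (sqseries_trunc_le f n m) _.
exact: le_trans (ler_norm _) fn.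
Qed.

(** Finite combinations of the basis are dense, and [X] does not see them: [X f] is the image of an
    arbitrarily small tail of [f]. *)
Lemma bounded_operator_eq0 (R : realType) (X : {linear ell2 R -> ell2 R}) :
  bounded_operator X -> (forall k, X (std_basis k) = 0) -> X =1 (fun=> 0).
Proof.
move=> [M XM] X0 f; apply: ell2_norm_eq0; apply/eqP.
rewrite eq_le sqrtr_ge0 andbT; apply/ler_addgt0Pl => e e0; rewrite addr0.
(* The bound [M] may be nonpositive, so a positive one is taken before dividing by it. *)
have M0 : 0 < Num.max M 1 by rewrite lt_max ltr01 orbT.
have [n fn] := cvg_ell2_trunc f (divr_gt0 e0 M0).
have -> : X f = X (f - \sum_(0 <= j < n) f j *: std_basis j).
  by rewrite linearB linear_sum big1 ?subr0// => k _; rewrite linearZ_LR X0 scaler0.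
have := XM (f - \sum_(0 <= j < n) f j *: std_basis j).
rewrite !ell2_normE -rmorphM lecR => /le_trans; apply.
rewrite -[leRHS](divfK (lt0r_neq0 M0)) [leRHS]mulrC.
apply: le_trans (ler_wpM2l (ltW M0) fn).
by apply: ler_wpM2r; rewrite ?sqrtr_ge0// le_max lexx.
Qed.

(** Induction on the row [n], for all columns [k] at once, since the recurrence also calls column
    [k - 1]. The guard [j <= k] excludes the truncated values of [k - j]. *)
Lemma extended_eigenoperator_euler (R : realType) (lambda : R)
    (X : {linear ell2 R -> ell2 R}) k n :
  (forall f, X f - shift_adj (X f) = lambda%:C *: X (f - shift_adj f)) ->
  X (std_basis k) n = euler lambda
    (fun j => if (j <= k)%N then X (std_basis (k - j)) 0 else 0) n.
Proof.
move=> XE.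
have XS f m : X f m.+1 =
    (1 - lambda%:C) * X f m + lambda%:C * X (shift_adj f) m.
  have : (X f - shift_adj (X f)) m = (lambda%:C *: (X f - X (shift_adj f))) m.
    by rewrite XE linearB.
  rewrite [LHS](_ : _ = X f m - X f m.+1)//.
  rewrite [RHS](_ : _ = lambda%:C * (X f m - X (shift_adj f) m))// => E.
  by rewrite -[LHS](subKr (X f m)) E; ring.
elim: n k => [|n IHn] k; first by rewrite euler0 subn0.
rewrite XS eulerS IHn; congr (_ + _ * _).
(* For [k = 0] both second terms vanish: $S^* e_0 = 0$, and the transformed sequence is supported at
   [j = 0]. *)
case: k => [|k].
  rewrite (_ : shift_adj _ = 0) ?linear0; last by apply: val_inj; apply/funext.
  by rewrite /euler big1// => j _; rewrite mulr0.
rewrite (_ : shift_adj _ = std_basis k) ?IHn//.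
by apply: val_inj; apply/funext.
Qed.

Theorem theorem2p3 (R : realType) (lambda : R) (X : {linear ell2 R -> ell2 R})
  (hlambda : 0 < lambda <= 1)
  (hX : extended_eigenoperator (fun f => f - shift_adj f) lambda%:C X) :
  exists (alpha : int -> R[i]) (n0 : nat),
    [/\ alpha 0 != 0, coanalytic alpha &
        forall k : nat,
          X (std_basis k) = euler lambda
            (matrix_apply (toeplitz alpha) (iter n0 shift_adj (std_basis k)))
          :> (nat -> R[i])].
Proof.
have [Xneq0 Xbounded XE] := hX.
have [n0 bn0 n0_min] : exists2 n0, X (std_basis n0) 0 != 0 &
    forall k, (k < n0)%N -> X (std_basis k) 0 = 0.
  have exb : exists k, X (std_basis k) 0 != 0.
    apply: contra_notP Xneq0 => /forallNP b0.
    apply: bounded_operator_eq0 => // k; apply: val_inj; apply/funext => n /=.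
    rewrite (extended_eigenoperator_euler k n XE) /euler big1// => j _.
    have /negP/negPn/eqP-> := b0 (k - j)%N.
    by rewrite if_same mulr0.
  case: (ex_minnP exb) => n0 bn0 n0_min; exists n0 => // k.
  by rewrite ltnNge; apply: contraNeq => /n0_min.
(* On and above the diagonal, $\alpha_{-m} = b_{n_0+m}$. *)
exists (fun z => if z <= 0 then X (std_basis (n0 + `|z|)) 0 else 0), n0.
split; first by rewrite lexx addn0.
  by move=> z z0; rewrite leNgt z0.
move=> k; apply/funext => n; rewrite (extended_eigenoperator_euler k n XE).
congr (euler _ _ _); apply/funext => j; rewrite toeplitz_iter_shift_adj_basis.
(* Wherever the Toeplitz side is zero, that is for [k < n0] or [j > k - n0], an index [k - j] with
   [j <= k] is below [n0], so $b_{k-j} = 0$ by minimality. *)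
case: (leqP n0 k) => n0k; last by case: ifP => // _; apply: n0_min; lia.
case: (leqP j (k - n0)) => jk.
  by rewrite !ifT; [congr (X (std_basis _) _); lia| lia..].
rewrite [RHS]ifF; last lia.
by case: ifP => // jk'; apply: n0_min; lia.
Qed.
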